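(* Let $K$ be a number field of degree $n=[K:\mathbf{Q}]$. Then there exist infinitely many elliptic curves $E/K$ that are pairwise non-isomorphic over an algebraic closure of $K$, and for which $E(\mathbf{A}_K)$ is a topological group that is not isomorphic (as a topological group) to $$\mathcal{E}_n=(\mathbf{R}/\mathbf{Z})^n\times\widehat{\mathbf{Z}}^n\times\prod_{m=1}^\infty \mathbf{Z}/m\mathbf{Z}.$$
   Context: Adelic point group: for an elliptic curve $E$ over a number field $K$, $E(\mathbf{A}_K)=\prod_{\mathfrak{p}\le\infty}E(K_\mathfrak{p})$, the product over all finite and infinite primes $\mathfrak{p}$ of $K$ of the point groups over the completions $K_\mathfrak{p}$, each with its natural ($\mathfrak{p}$-adic, real or complex) topology, and the product carrying the product topology. $\widehat{\mathbf{Z}}$ is the profinite completion of $\mathbf{Z}$; each $\mathbf{Z}/m\mathbf{Z}$ is discrete. *)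

(* Defs.v *)
From HB Require Import structures.
From mathcomp Require Import all_boot all_order all_algebra all_field.
From mathcomp Require Import all_classical all_reals all_analysis.
From mathcomp Require Import ring lra.

Set Implicit Arguments.
Unset Strict Implicit.
Unset Printing Implicit Defensive.
Import Order.TTheory GRing.Theory Num.Theory.
Import numFieldNormedType.Exports.
Local Open Scope classical_set_scope.
Local Open Scope ring_scope.
Local Open Scope quotient_scope.

Record absval (R : realType) (F : fieldType) := AbsVal {
  av :> F -> R;
  av_ge0 : forall x, 0 <= av x;
  av_eq0 : forall x, av x = 0 <-> x = 0;
  avM : forall x y, av (x * y) = av x * av y;
  avD : forall x y, av (x + y) <= av x + av y
}.

Definition av_nontrivial (R : realType) (F : fieldType) (v : absval R F) :=
  exists2 x : F, x != 0 & v x != 1.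

Definition av_equiv (R : realType) (F : fieldType) (v w : absval R F) :=
  exists2 s : R, 0 < s & forall x, w x = v x `^ s.

Section AbsValTheory.
Variables (R : realType) (F : fieldType) (v : absval R F).
Implicit Types x y : F.

Lemma av0 : v 0 = 0. Proof. exact/av_eq0. Qed.

Lemma av_gt0 x : x != 0 -> 0 < v x.
Proof.
by move=> x0; rewrite lt_neqAle av_ge0 andbT eq_sym; apply/eqP => /av_eq0/eqP; apply/negP.
Qed.

Lemma av1 : v 1 = 1.
Proof.
have v1 : v 1 != 0 by rewrite gt_eqF// av_gt0 ?oner_eq0.
by apply: (mulfI v1); rewrite -avM !mulr1.
Qed.

Lemma avN x : v (- x) = v x.
Proof.
have vN1 : v (- 1) = 1.
  apply/eqP; rewrite -(@eqrXn2 _ 2)// ?av_ge0//.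
  by rewrite expr1n expr2 -avM mulrNN mulr1 av1.
by rewrite -mulN1r avM vN1 mul1r.
Qed.

Lemma avB x y : v (x - y) = v (y - x). Proof. by rewrite -avN opprB. Qed.

Lemma avV x : v x^-1 = (v x)^-1.
Proof.
have [->|x0] := eqVneq x 0; first by rewrite invr0 av0 invr0.
have vx0 : v x != 0 by rewrite gt_eqF// av_gt0.
by apply: (mulfI vx0); rewrite -avM !divff// av1.
Qed.

Lemma avDB x y z : v (x - z) <= v (x - y) + v (y - z).
Proof. by apply: le_trans (avD _ _ _); rewrite addrA subrK. Qed.

Lemma av_dist x y : `|v x - v y| <= v (x - y).
Proof.
rewrite ler_norml lerBlDr lerNl opprB lerBlDr; apply/andP; split.
  by rewrite avB (le_trans _ (avD _ _ _))// subrK.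
by rewrite (le_trans _ (avD _ _ _))// subrK.
Qed.

End AbsValTheory.

(* The completion of F at v: Cauchy sequences modulo null sequences. *)
Section Completion.
Variables (R : realType) (F : fieldType) (v : absval R F).

Definition cauchy_seq : {pred nat -> F} := fun u =>
  `[< forall e : R, 0 < e -> exists N, forall m n,
        (N <= m)%N -> (N <= n)%N -> v (u m - u n) < e >].

Lemma cauchy_bound u : u \in cauchy_seq ->
  exists2 M : R, 0 < M & forall n, v (u n) <= M.
Proof.
move=> /asboolP/(_ 1 ltr01)[N uN].
exists (1 + \sum_(i < N.+1) v (u i)).
  by rewrite ltr_wpDr// sumr_ge0// => i _; exact: av_ge0.
move=> n; have [nN|/ltnW Nn] := ltnP n N.+1.
  rewrite (bigD1 (Ordinal nN))//= addrCA lerDl addr_ge0// sumr_ge0// => i _.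
  exact: av_ge0.
rewrite -[u n](subrK (u N)) (le_trans (avD _ _ _))// lerD//.
  by rewrite ltW// uN.
rewrite big_ord_recr/= lerDr sumr_ge0// => i _; exact: av_ge0.
Qed.

Lemma cauchy_seq_subring : subring_closed cauchy_seq.
Proof.
split.
- by apply/asboolP => e e0; exists 0%N => m n _ _; rewrite subrr av0.
- move=> u w /asboolP uc /asboolP wc; apply/asboolP => e e0.
  have e2 : 0 < e / 2 by rewrite divr_gt0.
  have [[N uN] [M wM]] := (uc _ e2, wc _ e2).
  exists (maxn N M) => m n; rewrite !geq_max => /andP[Nm Mm] /andP[Nn Mn].
  have -> : (u - w) m - (u - w) n = (u m - u n) + (w n - w m).
    rewrite !fctE; ring.
  rewrite (le_lt_trans (avD _ _ _))// (splitr e) ltrD ?uN// wM//.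
- move=> u w uc wc.
  have [A A0 uA] := cauchy_bound uc; have [B B0 wB] := cauchy_bound wc.
  move: uc wc => /asboolP uc /asboolP wc; apply/asboolP => e e0.
  have eA : 0 < e / 2 / A by rewrite !divr_gt0.
  have eB : 0 < e / 2 / B by rewrite !divr_gt0.
  have [[N uN] [M wM]] := (uc _ eB, wc _ eA).
  exists (maxn N M) => m n; rewrite !geq_max => /andP[Nm Mm] /andP[Nn Mn].
  have -> : (u * w) m - (u * w) n = u m * (w m - w n) + (u m - u n) * w n.
    rewrite !fctE; ring.
  rewrite (le_lt_trans (avD _ _ _))// (splitr e) !avM ltrD//.
    rewrite (le_lt_trans (ler_wpM2r (av_ge0 _ _) (uA m)))//.
    by rewrite mulrC -ltr_pdivlMr// wM.
  rewrite (le_lt_trans (ler_wpM2l (av_ge0 _ _) (wB n)))//.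
  by rewrite -ltr_pdivlMr// uN.
Qed.

HB.instance Definition _ :=
  GRing.isSubringClosed.Build (nat -> F) cauchy_seq cauchy_seq_subring.

Record cauchySeq := CauchySeq { cs_val :> nat -> F; cs_valP : cs_val \in cauchy_seq }.
HB.instance Definition _ := [isSub for cs_val].
HB.instance Definition _ := [Choice of cauchySeq by <:].
HB.instance Definition _ := [SubChoice_isSubComNzRing of cauchySeq by <:].

Definition null_seq : {pred cauchySeq} := fun u =>
  `[< forall e : R, 0 < e -> exists N, forall n, (N <= n)%N -> v (u n) < e >].

Lemma null_seq_ideal : idealr_closed null_seq.
Proof.
split.
- by apply/asboolP => e e0; exists 0%N => n _; rewrite av0.
- apply/asboolP => /(_ 1 ltr01)[N /(_ N (leqnn N))].
  by rewrite av1 ltxx.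
- move=> a u w /asboolP uc /asboolP wc; apply/asboolP => e e0.
  have [A A0 aA] := cauchy_bound (cs_valP a).
  have e2 : 0 < e / 2 by rewrite divr_gt0.
  have eA : 0 < e / 2 / A by rewrite !divr_gt0.
  have [[N uN] [M wM]] := (uc _ eA, wc _ e2).
  exists (maxn N M) => n; rewrite !geq_max => /andP[Nn Mn].
  rewrite (le_lt_trans (avD _ _ _))// (splitr e) ltrD ?wM// avM.
  rewrite (le_lt_trans (ler_wpM2r (av_ge0 _ _) (aA n)))//.
  by rewrite mulrC -ltr_pdivlMr// uN.
Qed.

HB.instance Definition _ := isIdealr.Build cauchySeq null_seq null_seq_ideal.

Definition completion : Type := {ideal_quot null_seq}.
HB.instance Definition _ := GRing.ComNzRing.on completion.

Definition cs_class (u : cauchySeq) : completion := \pi_({ideal_quot null_seq}) u.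
HB.instance Definition _ := GRing.RMorphism.copy cs_class (\pi_({ideal_quot null_seq})).
Definition cs_repr (x : completion) : cauchySeq := repr (x : {ideal_quot null_seq}).

Lemma cs_reprK : cancel cs_repr cs_class.
Proof. exact: reprK. Qed.

Lemma pi_null (u : cauchySeq) :
  (cs_class u == 0 :> completion) = (u \in null_seq).
Proof.
by rewrite /cs_class -(rmorph0 cs_class) /cs_class -Quotient.idealrBE subr0.
Qed.

Lemma not_null_bound (u : cauchySeq) : u \notin null_seq ->
  exists2 c : R, 0 < c & exists N, forall n, (N <= n)%N -> c <= v (u n).
Proof.
move=> /asboolPn/existsNP[e /not_implyP[e0 /forallNP ue]].
have e2 : 0 < e / 2 by rewrite divr_gt0.
have /asboolP/(_ _ e2)[N uN] := cs_valP u.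
exists (e / 2) => //; exists N => n Nn.
have /existsNP[m /not_implyP[Nm /negP]] := ue N.
rewrite -leNgt => eum.
have := le_trans eum (_ : v (u m) <= v (u m - u n) + v (u n)).
rewrite -[X in v X <= _](subrK (u n)) avD => /(_ isT).
have := uN _ _ Nm Nn; rewrite {2}(splitr e); lra.
Qed.

Lemma completion_inv (x : completion) : x != 0 -> exists y, y * x = 1.
Proof.
rewrite -[x]cs_reprK; set u := cs_repr x.
rewrite pi_null => /not_null_bound[c c0 [N uN]].
pose w n := (u n)^-1.
have wc : w \in cauchy_seq.
  apply/asboolP => e e0.
  have ec : 0 < e * c ^+ 2 by rewrite mulr_gt0 ?exprn_gt0.
  have /asboolP/(_ _ ec)[M uM] := cs_valP u.
  exists (maxn N M) => m n; rewrite !geq_max => /andP[Nm Mm] /andP[Nn Mn].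
  have um0 : 0 < v (u m) by rewrite (lt_le_trans c0) ?uN.
  have un0 : 0 < v (u n) by rewrite (lt_le_trans c0) ?uN.
  have unz k : 0 < v (u k) -> u k != 0.
    by apply: contraTneq => ->; rewrite av0 ltxx.
  have -> : w m - w n = (u n - u m) / (u m * u n).
    by rewrite /w; field; rewrite !unz.
  rewrite avM avV avM ltr_pdivrMr ?mulr_gt0// (lt_le_trans (uM _ _ Mn Mm))//.
  by rewrite ler_pM2l// expr2 ler_pM ?uN// ltW.
exists (cs_class (CauchySeq wc)); apply/eqP.
rewrite -(rmorph1 cs_class).
rewrite -(rmorphM cs_class).
rewrite -subr_eq0 -(rmorphB cs_class) pi_null.
apply/asboolP => e e0; exists N => n Nn.
have un0 : u n != 0.
  by apply: contraTneq (lt_le_trans c0 (uN _ Nn)) => ->; rewrite av0 ltxx.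
suff -> : (CauchySeq wc * u - 1 : cauchySeq) n = 0 by rewrite av0.
by rewrite -[LHS]/((u n)^-1 * u n - 1) mulVf// subrr.
Qed.

Let cinv (x : completion) : completion :=
  if pselect (x != 0) is left x0 then sval (cid (completion_inv x0)) else 0.

Let cinvV x : x != 0 -> cinv x * x = 1.
Proof. by rewrite /cinv; case: pselect => // x0 _; case: cid. Qed.

Let cinv0 : cinv 0 = 0.
Proof. by rewrite /cinv; case: pselect => // x0; case/negP: (x0). Qed.

HB.instance Definition _ := GRing.ComNzRing_isField.Build completion cinvV cinv0.

Lemma cst_cauchy (x : F) : (fun=> x) \in cauchy_seq.
Proof. by apply/asboolP => e e0; exists 0%N => m n _ _; rewrite subrr av0. Qed.

Definition to_completion (x : F) : completion := cs_class (CauchySeq (cst_cauchy x)).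

Lemma to_completion_zmod : zmod_morphism to_completion.
Proof.
move=> x y; rewrite /to_completion.
rewrite -(rmorphB cs_class); congr (cs_class _).
exact: val_inj.
Qed.

Lemma to_completion_monoid : monoid_morphism to_completion.
Proof.
split=> [|x y]; rewrite /to_completion.
  rewrite -(rmorph1 cs_class); congr (cs_class _).
  exact: val_inj.
rewrite -(rmorphM cs_class); congr (cs_class _).
exact: val_inj.
Qed.

HB.instance Definition _ :=
  GRing.isZmodMorphism.Build F completion to_completion to_completion_zmod.
HB.instance Definition _ :=
  GRing.isMonoidMorphism.Build F completion to_completion to_completion_monoid.

Definition completion_av (x : completion) : R := lim (v (cs_repr x n) @[n --> \oo]).

Lemma completion_av_cvg (u : cauchySeq) :
  v (u n) @[n --> \oo] --> completion_av (cs_class u).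
Proof.
have cvgu (w : cauchySeq) : cvg (v (w n) @[n --> \oo]).
  apply/cauchy_cvgP/cauchy_ballP => e e0; near_simpl.
  have /asboolP/(_ _ e0)[N wN] := cs_valP w.
  near=> m n.
  rewrite /ball/= (le_lt_trans (av_dist _ _ _))// wN//.
  - by near: m; exact: nbhs_infty_ge.
  - by near: n; exact: nbhs_infty_ge.
have : cs_class u - cs_class (cs_repr (cs_class u)) == 0 :> completion.
  by rewrite cs_reprK subrr.
rewrite -(rmorphB cs_class) pi_null => /asboolP un.
set w := cs_repr _ in un *.
rewrite /completion_av -/w.
suff d0 : v (u n) - v (w n) @[n --> \oo] --> (0 : R).
  have -> : (fun n => v (u n)) = (fun n => (v (u n) - v (w n)) + v (w n)).
    by apply/funext => n; rewrite subrK.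
  rewrite -[X in _ --> X]add0r; apply: cvgD => //; exact: cvgu.
apply/cvgr0Pnorm_lt => e e0; have [N uN] := un _ e0.
near=> n; rewrite (le_lt_trans (av_dist _ _ _))// uN//.
by near: n; exact: nbhs_infty_ge.
Unshelve. all: by end_near. Qed.

Lemma completion_avE (u : cauchySeq) (a : R) :
  v (u n) @[n --> \oo] --> a -> completion_av (cs_class u) = a.
Proof.
move=> va; have := completion_av_cvg (u := u).
by move=> /(cvg_lim (@Rhausdorff R)) <-; exact: (cvg_lim (@Rhausdorff R) va).
Qed.

Lemma null_seq_cvg (u : cauchySeq) :
  u \in null_seq <-> v (u n) @[n --> \oo] --> (0 : R).
Proof.
split=> [/asboolP un|u0].
  apply/cvgr0Pnorm_lt => e e0; have [N uN] := un _ e0.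
  near=> n; rewrite ger0_norm ?av_ge0// uN//.
  by near: n; exact: nbhs_infty_ge.
apply/asboolP => e e0; move/cvgr0Pnorm_lt: u0 => /(_ e e0)[N _ uN].
by exists N => n Nn; rewrite (le_lt_trans (ler_norm _))//; exact: uN.
Unshelve. all: by end_near. Qed.

Lemma completion_av_ge0 x : 0 <= completion_av x.
Proof.
rewrite -[x]cs_reprK; apply: (cvgr_to_ge (@completion_av_cvg (cs_repr x))).
by near=> n; exact: av_ge0.
Unshelve. all: by end_near. Qed.

Lemma completion_av_eq0 x : completion_av x = 0 <-> x = 0.
Proof.
rewrite -[x]cs_reprK; set u := cs_repr x; split=> [u0|/eqP].
  apply/eqP; rewrite pi_null; apply/null_seq_cvg.
  by rewrite -u0; exact: completion_av_cvg.
by rewrite pi_null => /null_seq_cvg/completion_avE.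
Qed.

Lemma completion_avM x y :
  completion_av (x * y) = completion_av x * completion_av y.
Proof.
rewrite -[x]cs_reprK -[y]cs_reprK; set u := cs_repr x; set w := cs_repr y.
rewrite -(rmorphM cs_class); apply: completion_avE.
rewrite [X in X @ _ --> _](_ : _ = fun n => v (u n) * v (w n)).
  by apply: cvgM; exact: completion_av_cvg.
by apply/funext => n; rewrite -avM.
Qed.

Lemma completion_avD x y :
  completion_av (x + y) <= completion_av x + completion_av y.
Proof.
rewrite -[x]cs_reprK -[y]cs_reprK; set u := cs_repr x; set w := cs_repr y.
rewrite -(rmorphD cs_class).
apply: (ler_cvg_to (@completion_av_cvg (u + w))
          (cvgD (@completion_av_cvg u) (@completion_av_cvg w))).
by near=> n; exact: avD.
Unshelve. all: by end_near. Qed.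

Definition completion_absval : absval R completion :=
  AbsVal completion_av_ge0 completion_av_eq0 completion_avM completion_avD.

Lemma completion_absval_ext (x : F) : completion_absval (to_completion x) = v x.
Proof.
apply: (@completion_avE (CauchySeq (cst_cauchy x))).
exact: (@cvg_cst R (v x) nat \oo _).
Qed.

End Completion.

(* F with the metric topology of v. *)
Definition valued (R : realType) (F : fieldType) (v : absval R F) : Type := F.

Section Valued.
Variables (R : realType) (F : fieldType) (v : absval R F).
HB.instance Definition _ := GRing.Field.on (valued v).

Definition valued_open (U : set (valued v)) := forall x, U x ->
  exists2 e : R, 0 < e & forall y : F, v (y - x) < e -> U y.

Lemma valued_openT : valued_open setT.
Proof. by move=> x _; exists 1. Qed.

Lemma valued_openI : setI_closed valued_open.
Proof.
move=> A B oA oB x [Ax Bx].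
have [[a a0 aA] [b b0 bB]] := (oA x Ax, oB x Bx).
exists (Num.min a b); first by rewrite lt_min a0.
by move=> y; rewrite lt_min => /andP[/aA ? /bB].
Qed.

Lemma valued_open_bigU (I : Type) (f : I -> set (valued v)) :
  (forall i, valued_open (f i)) -> valued_open (\bigcup_i f i).
Proof.
move=> of_ x [i _ fix_]; have [e e0 eU] := of_ i x fix_.
by exists e => // y /eU fiy; exists i.
Qed.

HB.instance Definition _ :=
  isOpenTopological.Build (valued v) valued_openT valued_openI valued_open_bigU.
End Valued.

(* y^2 + a1 x y + a3 y = x^3 + a2 x^2 + a4 x + a6 *)
Record weierstrass (F : Type) := Weierstrass {
  wa1 : F; wa2 : F; wa3 : F; wa4 : F; wa6 : F
}.

Section EllipticCurves.
Variable F : fieldType.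
Implicit Type W : weierstrass F.

Definition wb2 W := wa1 W ^+ 2 + 4 * wa2 W.
Definition wb4 W := 2 * wa4 W + wa1 W * wa3 W.
Definition wb6 W := wa3 W ^+ 2 + 4 * wa6 W.
Definition wb8 W := wa1 W ^+ 2 * wa6 W + 4 * wa2 W * wa6 W
  - wa1 W * wa3 W * wa4 W + wa2 W * wa3 W ^+ 2 - wa4 W ^+ 2.
Definition wdisc W :=
  - wb2 W ^+ 2 * wb8 W - 8 * wb4 W ^+ 3 - 27 * wb6 W ^+ 2
  + 9 * wb2 W * wb4 W * wb6 W.

Record ellCurve := EllCurve {
  ec_model :> weierstrass F;
  ec_disc : wdisc ec_model != 0
}.

(* E1 is carried to E2 by (x, y) = (u^2 x' + r, u^3 y' + s u^2 x' + t); these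
   substitutions are the isomorphisms over F between Weierstrass curves that
   respect the point at infinity. *)
Definition ec_isom (E1 E2 : ellCurve) : Prop :=
  exists u r s t : F, [/\ u != 0
    & [/\ u * wa1 E2 = wa1 E1 + 2 * s,
     u ^+ 2 * wa2 E2 = wa2 E1 - s * wa1 E1 + 3 * r - s ^+ 2,
     u ^+ 3 * wa3 E2 = wa3 E1 + r * wa1 E1 + 2 * t,
     u ^+ 4 * wa4 E2 = wa4 E1 - s * wa3 E1 + 2 * r * wa2 E1
       - (t + r * s) * wa1 E1 + 3 * r ^+ 2 - 2 * s * t
   & u ^+ 6 * wa6 E2 = wa6 E1 + r * wa4 E1 + r ^+ 2 * wa2 E1 + r ^+ 3
       - t * wa3 E1 - t ^+ 2 - r * t * wa1 E1]].

Variable E : ellCurve.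
Let a1 := wa1 E.
Let a2 := wa2 E.
Let a3 := wa3 E.
Let a4 := wa4 E.
Let a6 := wa6 E.

(* None is the point at infinity. *)
Definition on_curve (P : option (F * F)) : bool :=
  if P is Some (x, y) then
    y ^+ 2 + a1 * x * y + a3 * y == x ^+ 3 + a2 * x ^+ 2 + a4 * x + a6
  else true.

Record ec_point := ECPoint { ec_coord :> option (F * F); _ : on_curve ec_coord }.
HB.instance Definition _ := [isSub for ec_coord].
HB.instance Definition _ := [Choice of ec_point by <:].

(* The chord-tangent law. *)
Definition add_coord (P Q : option (F * F)) : option (F * F) :=
  match P, Q with
  | None, _ => Q
  | _, None => P
  | Some (x1, y1), Some (x2, y2) =>
    if (x1 == x2) && (y1 + y2 + a1 * x2 + a3 == 0) then None else
    let l := if x1 == x2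
      then (3 * x1 ^+ 2 + 2 * a2 * x1 + a4 - a1 * y1) / (2 * y1 + a1 * x1 + a3)
      else (y2 - y1) / (x2 - x1) in
    let x3 := l ^+ 2 + a1 * l - a2 - x1 - x2 in
    Some (x3, - (l + a1) * x3 - (y1 - l * x1) - a3)
  end.

Let chord_on_curve x1 y1 x2 l :
  on_curve (Some (x1, y1)) ->
  a4 = l * (2 * y1 + l * (x2 - x1)) + a1 * (y1 + l * x2) + a3 * l
       - (x2 ^+ 2 + x1 * x2 + x1 ^+ 2) - a2 * (x1 + x2) ->
  let x3 := l ^+ 2 + a1 * l - a2 - x1 - x2 in
  on_curve (Some (x3, - (l + a1) * x3 - (y1 - l * x1) - a3)).
Proof.
move=> /= /eqP P1 Ea4; apply/eqP.
have -> : a6 = y1 ^+ 2 + a1 * x1 * y1 + a3 * y1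
               - (x1 ^+ 3 + a2 * x1 ^+ 2 + a4 * x1) by rewrite P1; ring.
rewrite Ea4; ring.
Qed.

Lemma add_coord_on_curve (P Q : ec_point) : on_curve (add_coord P Q).
Proof.
case: P Q => [[[x1 y1]|] //= P1] [[[x2 y2]|] //= P2].
have [x12|x12] := eqVneq x1 x2 => /=; last first.
  apply: chord_on_curve => //.
  have d0 : x2 - x1 != 0 by rewrite subr_eq0 eq_sym.
  apply: (mulfI d0); move/eqP: P1 => P1; move/eqP: P2 => P2.
  have : (x2 - x1) * a4 =
    (y2 ^+ 2 + a1 * x2 * y2 + a3 * y2) - (y1 ^+ 2 + a1 * x1 * y1 + a3 * y1)
    - (x2 ^+ 3 - x1 ^+ 3) - a2 * (x2 ^+ 2 - x1 ^+ 2) by rewrite P1 P2; ring.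
  by move=> ->; field.
subst x2; case: ifP => // /negbT s0; apply: chord_on_curve => //.
have y12 : y2 = y1.
  have : (y2 - y1) * (y1 + y2 + a1 * x1 + a3) == 0.
    rewrite -(subr_eq0 (y2 ^+ 2 + a1 * x1 * y2 + a3 * y2)) in P2.
    rewrite -(subr_eq0 (y1 ^+ 2 + a1 * x1 * y1 + a3 * y1)) in P1.
    move/eqP: P1 => P1; move/eqP: P2 => P2; apply/eqP.
    by rewrite -[RHS](subrr 0) -{1}P2 -P1; ring.
  by rewrite mulf_eq0 (negPf s0) orbF subr_eq0 => /eqP.
subst y2; have d0 : 2 * y1 + a1 * x1 + a3 != 0.
  by apply: contra s0 => /eqP <-; apply/eqP; ring.
by field.
Qed.

Definition ec_add (P Q : ec_point) : ec_point := ECPoint (add_coord_on_curve P Q).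

End EllipticCurves.

Section BaseChange.
Variables (F L : fieldType) (f : {rmorphism F -> L}).

Definition weierstrass_map (W : weierstrass F) : weierstrass L :=
  Weierstrass (f (wa1 W)) (f (wa2 W)) (f (wa3 W)) (f (wa4 W)) (f (wa6 W)).

Lemma wdisc_map W : wdisc (weierstrass_map W) = f (wdisc W).
Proof.
by rewrite /wdisc /wb2 /wb4 /wb6 /wb8 /=; ring.
Qed.

Lemma wdisc_map_neq0 (E : ellCurve F) : wdisc (weierstrass_map E) != 0.
Proof. by rewrite wdisc_map fmorph_eq0 ec_disc. Qed.

Definition ec_map (E : ellCurve F) : ellCurve L := EllCurve (wdisc_map_neq0 E).
End BaseChange.

(* The topology of E(F) as a subset of the projective plane over F: the quotient
   topology of the punctured cone of homogeneous coordinates over the curve. *)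
Section PointTopology.
Variables (R : realType) (F : fieldType) (v : absval R F) (E : ellCurve F).

Definition ec_cone : set (valued v * valued v * valued v) :=
  [set p | let: (X, Y, Z) := p in
    ~ (X = 0 /\ Y = 0 /\ Z = 0) /\
    Y ^+ 2 * Z + wa1 E * X * Y * Z + wa3 E * Y * Z ^+ 2 =
    X ^+ 3 + wa2 E * X ^+ 2 * Z + wa4 E * X * Z ^+ 2 + wa6 E * Z ^+ 3].

Definition dehomogenize (p : F * F * F) : option (F * F) :=
  let: (X, Y, Z) := p in if Z == 0 then None else Some (X / Z, Y / Z).

Lemma dehomogenize_on_curve (p : ec_cone) : on_curve E (dehomogenize (set_val p)).
Proof.
case: p => [[[X Y] Z] /= /set_mem[_ XYZ]].
have [//|Z0 /=] := eqVneq (Z : F) 0.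
have Z3 : (Z : F) ^+ 3 != 0 by rewrite expf_neq0.
apply/eqP/(mulIf Z3); transitivity (Y ^+ 2 * Z + wa1 E * X * Y * Z + wa3 E * Y * Z ^+ 2).
  by field.
by rewrite XYZ; field.
Qed.

Definition ec_proj (p : ec_cone) : ec_point E := ECPoint (dehomogenize_on_curve p).

Definition ec_points (_ : absval R F) : Type := ec_point E.
HB.instance Definition _ := Choice.on (ec_points v).

Definition ec_open (U : set (ec_points v)) := open (ec_proj @^-1` U).

Lemma ec_openT : ec_open setT.
Proof. by rewrite /ec_open preimage_setT; exact: openT. Qed.

Lemma ec_openI : setI_closed ec_open.
Proof. by move=> A B oA oB; exact: openI. Qed.

Lemma ec_open_bigU (I : Type) (f : I -> set (ec_points v)) :
  (forall i, ec_open (f i)) -> ec_open (\bigcup_i f i).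
Proof. by move=> of_; apply: bigcup_open => i _; exact: of_. Qed.

HB.instance Definition _ :=
  isOpenTopological.Build (ec_points v) ec_openT ec_openI ec_open_bigU.
End PointTopology.

(* A topological space with an addition. All instances below are topological
   groups; an isomorphism of topological groups only involves this data. *)
Record topGroupData := TopGroupData {
  tg_space :> topologicalType;
  tg_add : tg_space -> tg_space -> tg_space
}.

Definition tg_isom (G H : topGroupData) : Prop :=
  exists (f : G -> H) (g : H -> G),
    [/\ cancel f g, cancel g f, continuous f, continuous g
      & {morph f : x y / tg_add x y >-> tg_add x y}].

Definition tg_prod (I : Type) (G : I -> topGroupData) : topGroupData :=
  @TopGroupData (prod_topology G) (fun x y i => tg_add (x i) (y i)).

Definition tg_pair (G H : topGroupData) : topGroupData :=
  @TopGroupData (G * H)%type (fun x y => (tg_add x.1 y.1, tg_add x.2 y.2)).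

Definition tg_power (G : topGroupData) (n : nat) := tg_prod (fun _ : 'I_n => G).

Section StandardGroup.
Variable R : realType.

Definition integers : {pred R} := fun x => x \is a Num.int.

Lemma integers_zmod : zmod_closed integers.
Proof. by split=> [|x y]; [exact: int_num0 | exact: rpredB]. Qed.
HB.instance Definition _ := GRing.isZmodClosed.Build R integers integers_zmod.

Definition tg_circle : topGroupData :=
  @TopGroupData (quotient_topology {ideal_quot integers})
    (fun x y : {ideal_quot integers} => x + y).

(* Z/(m+1) *)
Definition tg_cyclic (m : nat) : topGroupData :=
  @TopGroupData (discrete_topology 'I_m.+1) (fun x y : 'I_m.+1 => x + y).

(* The inverse limit of the Z/(m+1) for the divisibility order. *)
Definition zhat : set (tg_prod tg_cyclic) :=
  [set x | forall d m, (d.+1 %| m.+1)%N ->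
    (x d : 'I_d.+1) = ((x m : 'I_m.+1) %% d.+1)%N :> nat].

Lemma zhat_add (x y : zhat) : tg_add (set_val x) (set_val y) \in zhat.
Proof.
apply/mem_set => d m dm /=; have := set_valP x; have := set_valP y.
move=> /(_ _ _ dm) yE /(_ _ _ dm) xE.
by rewrite [LHS]/= xE yE modnDm modn_dvdm.
Qed.

Definition tg_zhat : topGroupData :=
  @TopGroupData zhat (fun x y => SigSub (zhat_add x y)).

Definition standard_group (n : nat) : topGroupData :=
  tg_pair (tg_pair (tg_power tg_circle n) (tg_power tg_zhat n)) (tg_prod tg_cyclic).

End StandardGroup.

Definition ec_group (R : realType) (F : fieldType) (v : absval R F) (E : ellCurve F) :
    topGroupData :=
  @TopGroupData (ec_points E v) (@ec_add F E).

(* A prime of K, finite or infinite: an equivalence class of nontrivial absolute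
   values. *)
Record prime_of (R : realType) (K : fieldType) := PrimeOf {
  prime_class : set (absval R K);
  prime_classP : exists v, av_nontrivial v /\ prime_class = [set w | av_equiv v w]
}.

Definition prime_av (R : realType) (K : fieldType) (p : prime_of R K) : absval R K :=
  sval (cid (prime_classP p)).

Definition adelic_points (R : realType) (K : fieldType) (E : ellCurve K) :
    topGroupData :=
  tg_prod (fun p : prime_of R K =>
    ec_group (completion_absval (prime_av p))
      (ec_map (to_completion (prime_av p)) E)).

(* Main.v *)
(* If every 2-torsion point of E over every extension field L of K is twice an
   L-rational point, then so is every 2-torsion point of E(A_K); the group E_n,
   having a factor Z/2, contains elements of order 2 that are not doubles.

   Such E come from sections of GL_2(Z/4) -> GL_2(Z/2), that is from curves with
   Q(E[4]) = Q(E[2]). They form the family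
     y^2 = x^3 - 27 a^3 (a + 4) x - 54 a^4 r (a + 1),  r^2 = (a + 5)^2 + 2,
   with j-invariant -64 a (a + 4)^3. A root t of the cubic f is halved over L as
   soon as f'(t) = c^2 and f''(t)/2 + 2 c = m^2 with c, m in L, and in this family
   c and m are polynomials in t. *)
Require Import Defs.
From mathcomp Require Import all_boot all_order all_algebra all_field.
From mathcomp Require Import all_classical all_reals all_analysis.
From mathcomp Require Import ring lra.
Import Order.TTheory GRing.Theory Num.Theory.
Local Open Scope classical_set_scope.
Local Open Scope ring_scope.

(** * Halving 2-torsion points on short Weierstrass curves *)

Section Halving.
Variables (F : fieldType) (E : ellCurve F).
Hypotheses (a1 : wa1 E = 0) (a2 : wa2 E = 0) (a3 : wa3 E = 0).
Hypothesis two_neq0 : 2 != 0 :> F.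

Lemma short_disc_neq0 : 4 * wa4 E ^+ 3 + 27 * wa6 E ^+ 2 != 0.
Proof.
apply: contraNneq (ec_disc E) => D0; apply/eqP.
rewrite /wdisc /wb2 /wb4 /wb6 /wb8 a1 a2 a3.
transitivity (- 16 * (4 * wa4 E ^+ 3 + 27 * wa6 E ^+ 2)); first by ring.
by rewrite D0 mulr0.
Qed.

(* The line y = m (x - t) is tangent to the curve at x = t + c. *)
Lemma halve_root (t c m : F) :
  t ^+ 3 + wa4 E * t + wa6 E = 0 ->
  c ^+ 2 = 3 * t ^+ 2 + wa4 E -> m ^+ 2 = 3 * t + 2 * c ->
  on_curve E (Some (t + c, m * c)) /\
  add_coord E (Some (t + c, m * c)) (Some (t + c, m * c)) = Some (t, 0).
Proof.
move=> ft cE mE; have D0 := short_disc_neq0.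
have A4 : wa4 E = c ^+ 2 - 3 * t ^+ 2 by rewrite cE; ring.
have A6 : wa6 E = - (t ^+ 3 + (c ^+ 2 - 3 * t ^+ 2) * t).
  by rewrite -A4; apply/eqP; rewrite -addr_eq0 addrC ft.
(* [c ^+ 2] is f'(t), so c = 0 would make t a double root of the cubic. *)
have c0 : c != 0.
  by apply: contraNneq D0 => c0; apply/eqP; rewrite A4 A6 c0; ring.
(* The quadratic cofactor of x - t has discriminant 9 t^2 - 4 c^2, a multiple of m^2 = 3 t + 2 c, so
   m = 0 would make the other two roots coincide. *)
have m0 : m != 0.
  apply: contraNneq D0 => m0; apply/eqP.
  have E0 : 3 * t + 2 * c = 0 by rewrite -mE m0 expr0n.
  have -> : 4 * wa4 E ^+ 3 + 27 * wa6 E ^+ 2 =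
    (3 * t + 2 * c) * (c ^+ 4 * (2 * c - 3 * t)).
    by rewrite A4 A6; ring.
  by rewrite E0 mul0r.
split.
  rewrite /= a1 a2 a3; apply/eqP.
  transitivity ((3 * t + 2 * c) * c ^+ 2); first by rewrite -mE; ring.
  by rewrite A4 A6; ring.
rewrite /= a1 a2 a3 eqxx /=.
have y0 : m * c + m * c + 0 * (t + c) + 0 != 0.
  by rewrite mul0r !addr0 -mulr2n -mulr_natl !mulf_neq0.
rewrite (negPf y0).
have -> : (3 * (t + c) ^+ 2 + 2 * 0 * (t + c) + wa4 E - 0 * (m * c)) /
    (2 * (m * c) + 0 * (t + c) + 0) = m.
  have -> : 3 * (t + c) ^+ 2 + 2 * 0 * (t + c) + wa4 E - 0 * (m * c) =
    m ^+ 2 * (2 * c) by rewrite mE A4; ring.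
  by field; rewrite two_neq0 c0 m0.
have -> : m ^+ 2 + 0 * m - 0 - (t + c) - (t + c) = t by rewrite mE; ring.
by congr (Some (_, _)); ring.
Qed.
End Halving.

(** * The family and its halving property *)

(* M parametrizes the conic r^2 = (a + 5)^2 + 2. *)
Definition family_a {F : fieldType} (M : F) : F := M - (2 * M)^-1 - 5.
Definition family_r {F : fieldType} (M : F) : F := M + (2 * M)^-1.

Definition family_model {F : fieldType} (M : F) : weierstrass F :=
  Weierstrass 0 0 0 (- 27 * family_a M ^+ 3 * (family_a M + 4))
    (- 54 * family_a M ^+ 4 * family_r M * (family_a M + 1)).

Lemma family_rE {F : fieldType} {M : F} : 2 * M != 0 ->
  family_r M ^+ 2 = family_a M ^+ 2 + 10 * family_a M + 27.
Proof.
rewrite mulf_eq0 negb_or => /andP[two0 M0].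
by rewrite /family_r /family_a; field; rewrite two0 M0.
Qed.

(** On the conic, r^2 (a + 1)^2 - a (a + 4)^3 = 27, which leaves only a power of a. *)
Lemma family_disc {F : fieldType} {M : F} : 2 * M != 0 ->
  wdisc (family_model M) = - 64 * 27 ^+ 4 * family_a M ^+ 8.
Proof.
move=> M0; rewrite /wdisc /wb2 /wb4 /wb6 /wb8 /=.
set a := family_a M; set r := family_r M.
transitivity (- 64 * 27 ^+ 3 * a ^+ 8 * (r ^+ 2 * (a + 1) ^+ 2 - a * (a + 4) ^+ 3)).
  by ring.
by rewrite family_rE// -/a; ring.
Qed.

Lemma family_half_root {F : fieldType} {M : F} (t : F) (W := family_model M) :
  3 != 0 :> F -> 2 * M != 0 -> family_a M != 0 ->
  t ^+ 3 + wa4 W * t + wa6 W = 0 ->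
  exists c m, c ^+ 2 = 3 * t ^+ 2 + wa4 W /\ m ^+ 2 = 3 * t + 2 * c.
Proof.
rewrite {}/W /= => three0 M0; have := family_rE M0.
have two0 : 2 != 0 :> F by apply: contraNneq M0 => ->; rewrite mul0r.
move: (family_a M) (family_r M) => a r rE a0 f0.
have den i j : (2 ^ i * 3 ^ j)%:R != 0 :> F.
  by rewrite natrM !natrX mulf_neq0 ?expf_neq0.
pose g := r ^+ 2 - (a ^+ 2 + 10 * a + 27).
have g0 : g = 0 by rewrite /g rE subrr.
pose f := t ^+ 3 - 27 * a ^+ 3 * (a + 4) * t - 54 * a ^+ 4 * r * (a + 1).
have {}f0 : f = 0 by rewrite /f -[RHS]f0; ring.
(* Let q1, q2, q3 be the roots of
   q^3 - 6 a q^2 + 18 a^2 q + 108 a^2, so that q1^2 + q2^2 + q3^2 = 0. The roots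
   of f are t3 = (q2^2 - q1^2) / 6i and its cyclic images, and then
   c = q1 q2 / 2 and m = (1 - i) (q2 + i q1) / 2. *)
pose c := a ^+ 2 * (2 * a + 11) + r / 3 * t - t ^+ 2 / (9 * a).
pose m := - (a * (a + 1) * (a + 6) + a * r * (a + 4)) / 3
  - (r + a + 7) / 18 * t + (a + 3 + r) / (54 * a ^+ 2) * t ^+ 2.
(* Both differences lie in the ideal generated by [f] and [g]; the cofactors are given
   explicitly. *)
exists c, m; split; apply/eqP; rewrite -subr_eq0; apply/eqP.
  transitivity (f * (t / (81 * a ^+ 2) - 2 * r / (27 * a)) +
      g * (t ^+ 2 / 9 - 4 * a ^+ 3 * (a + 1))).
    by rewrite /f /g /c; field; rewrite (den 0 2) (den 0 3) (den 0 4) three0 a0.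
  by rewrite f0 g0 !mul0r addr0.
transitivity (f * ((a + 3 + r) ^+ 2 / (2916 * a ^+ 4) * t
      - (r + a + 7) * (a + 3 + r) / (486 * a ^+ 2)) +
    g * (- t ^+ 2 / (81 * a) + (a ^+ 2 + a * r + 4 * a + r + 6) / 54 * t
      + a ^+ 2 * (6 - r - 4 * a - a * r - a ^+ 2) / 9)).
  rewrite /f /g /c /m; field; rewrite three0 a0 (den 0 2) (den 0 4) (den 1 2).
  by rewrite (den 1 3) (den 1 5) (den 2 6).
by rewrite f0 g0 !mul0r addr0.
Qed.

Lemma family_halving {F : fieldType} {M : F} (E : ellCurve F) (P : ec_point E) :
  ec_model E = family_model M ->
  3 != 0 :> F -> 2 * M != 0 -> family_a M != 0 ->
  add_coord E P P = None -> exists Q : ec_point E, ec_add Q Q = P.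
Proof.
move=> EM three0 M0 a0.
have two0 : 2 != 0 :> F by apply: contraNneq M0 => ->; rewrite mul0r.
case: P => [[[x y]|] Pon] /=; last first.
  by move=> _; exists (ECPoint (Pon : on_curve E None)); apply: val_inj.
rewrite eqxx /=; case: ifP => // y0 _.
have {}y0 : y = 0.
  move: y0; rewrite EM /= mul0r !addr0 -mulr2n -mulr_natl mulf_eq0 (negPf two0).
  by move/eqP.
have x0 : x ^+ 3 + wa4 (family_model M) * x + wa6 (family_model M) = 0.
  move: (Pon); rewrite /= y0 EM => /eqP /= xE.
  transitivity (x ^+ 3 + 0 * x ^+ 2 + wa4 (family_model M) * x +
    wa6 (family_model M)); first by rewrite mul0r addr0.
  by rewrite -[LHS]/(_ + _ + _ + _) /= -xE; ring.
have [c [m [cE mE]]] := family_half_root x three0 M0 a0 x0.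
rewrite -EM in x0 cE.
have [E1 E2 E3] : [/\ wa1 E = 0, wa2 E = 0 & wa3 E = 0] by rewrite EM.
have [Qon QQ] := halve_root F E E1 E2 E3 two0 x c m x0 cE mE.
exists (ECPoint Qon); apply: val_inj.
rewrite -[LHS]/(add_coord E (Some (x + c, m * c)) (Some (x + c, m * c))) QQ /=.
by rewrite y0.
Qed.

(** * Invariance of j within the family *)

Lemma family_isom {F : fieldType} {M N : F} (E1 E2 : ellCurve F) :
  ec_model E1 = family_model M -> ec_model E2 = family_model N ->
  3 != 0 :> F -> 2 * M != 0 -> 2 * N != 0 -> family_a M != 0 ->
  ec_isom E1 E2 ->
  family_a M * (family_a M + 4) ^+ 3 = family_a N * (family_a N + 4) ^+ 3.
Proof.
move=> E1M E2N three0 M0 N0 aM0 [u [r [s [t [_ []]]]]].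
have two0 : 2 != 0 :> F by apply: contraNneq M0 => ->; rewrite mul0r.
(* Both models have a1 = a2 = a3 = 0, so s, r and t vanish in turn and only the scaling u
   remains. *)
rewrite E1M E2N /= !mulr0 !add0r => /esym/eqP.
rewrite mulf_eq0 (negPf two0) => /eqP s0; rewrite {}s0.
rewrite expr0n /= !subr0 oppr0 add0r => /esym/eqP.
rewrite mulf_eq0 (negPf three0) /= => /eqP r0; rewrite {}r0.
move=> /esym/eqP; rewrite mulf_eq0 (negPf two0) => /eqP t0.
rewrite {}t0; have := family_rE M0; have := family_rE N0; move: aM0.
move: (family_a M) (family_a N) (family_r M) (family_r N) => a b k l a0 lE kE EA EB.
(* Cubing the a4 relation and squaring the a6 relation bring both to weight u^12. *)
have cubes : 27 ^+ 3 * (a ^+ 8 * (a * (a + 4) ^+ 3)) =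
             27 ^+ 3 * (u ^+ 12 * b ^+ 8 * (b * (b + 4) ^+ 3)).
  transitivity (- (- 27 * a ^+ 3 * (a + 4)) ^+ 3); first by ring.
  transitivity (- (u ^+ 4 * (- 27 * b ^+ 3 * (b + 4))) ^+ 3); last by ring.
  by rewrite EA; ring.
have squares : 54 ^+ 2 * (a ^+ 8 * (27 + a * (a + 4) ^+ 3)) =
               54 ^+ 2 * (u ^+ 12 * b ^+ 8 * (27 + b * (b + 4) ^+ 3)).
  transitivity ((- 54 * a ^+ 4 * k * (a + 1)) ^+ 2).
    transitivity (54 ^+ 2 * a ^+ 8 * (a + 1) ^+ 2 * k ^+ 2); last by ring.
    by rewrite kE; ring.
  transitivity ((u ^+ 6 * (- 54 * b ^+ 4 * l * (b + 1))) ^+ 2).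
    by rewrite EB; ring.
  transitivity (54 ^+ 2 * u ^+ 12 * b ^+ 8 * (b + 1) ^+ 2 * l ^+ 2); first by ring.
  by rewrite lE; ring.
have den i j : (2 ^ i * 3 ^ j)%:R != 0 :> F.
  by rewrite natrM !natrX mulf_neq0 ?expf_neq0.
have c0 : 27 ^+ 3 != 0 :> F by rewrite expf_neq0 ?(den 0 3).
have s0 : 54 ^+ 2 != 0 :> F by rewrite expf_neq0 ?(den 1 3).
move/(mulfI c0) in cubes; move/(mulfI s0) in squares.
(* The difference of the two relations is 27 times this one and compares the discriminants;
   cancelling it in [cubes] leaves j up to the factor -64. *)
have ab : a ^+ 8 = u ^+ 12 * b ^+ 8.
  apply: (mulfI (den 0 3)).
  transitivity (a ^+ 8 * (27 + a * (a + 4) ^+ 3) - a ^+ 8 * (a * (a + 4) ^+ 3)).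
    by ring.
  by rewrite squares cubes; ring.
by move: cubes; rewrite -ab; apply: mulfI; rewrite expf_neq0.
Qed.

(** * Base change of the family *)

Section Morphism.
Variables (F L : fieldType) (f : {rmorphism F -> L}).

Lemma family_a_morph M : f (family_a M) = family_a (f M).
Proof. by rewrite /family_a !rmorphB fmorphV rmorphM !rmorph_nat. Qed.

Lemma family_j_morph M :
  f (family_a M * (family_a M + 4) ^+ 3) =
  family_a (f M) * (family_a (f M) + 4) ^+ 3.
Proof. by rewrite -family_a_morph; ring. Qed.

Lemma family_r_morph M : f (family_r M) = family_r (f M).
Proof. by rewrite /family_r rmorphD fmorphV rmorphM rmorph_nat. Qed.

Lemma family_model_morph (M : F) :
  weierstrass_map f (family_model M) = family_model (f M).
Proof.
rewrite /weierstrass_map /family_model /= -family_a_morph -family_r_morph.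
by congr Weierstrass; ring.
Qed.
End Morphism.

(** * Separating j-invariants over an ordered field *)

Lemma family_a_gt0 (F : realFieldType) (x : F) : 6 <= x -> 0 < family_a x.
Proof.
move=> x6; have x0 : 0 < x by lra.
(* This gives [family_a x] > x - 6, whence the threshold 6. *)
have i0 : (2 * x)^-1 < 1 by rewrite invf_lt1; lra.
by rewrite /family_a; lra.
Qed.

Lemma family_a_mono (F : realFieldType) (x y : F) :
  0 < x -> x < y -> family_a x < family_a y.
Proof.
move=> x0 xy; have i0 : (2 * y)^-1 < (2 * x)^-1 by rewrite ltf_pV2 ?posrE; lra.
by rewrite /family_a; lra.
Qed.

(** For x >= 6, a is positive and increases with x, and a (a + 4)^3 increases with a > 0. *)
Lemma family_j_inj (F : realFieldType) :
  {in [pred x : F | 6 <= x] &,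
    injective (fun x => family_a x * (family_a x + 4) ^+ 3)}.
Proof.
move=> x y; rewrite !inE.
wlog xy : x y / x < y => [H x6 y6 E|].
  by case: (ltgtP x y) => [/H|/H|] //; [exact|move=> /(_ y6 x6 (esym E))].
move=> x6 y6 /eqP; rewrite lt_eqF// ltr_pM ?ltW ?family_a_gt0//.
- by rewrite exprn_gt0// addr_gt0 ?family_a_gt0.
- by apply: family_a_mono => //; lra.
rewrite ltrXn2r//; last 1 first.
- by rewrite ltrD2r; apply: family_a_mono => //; lra.
by rewrite addr_ge0 // ltW// family_a_gt0.
Qed.

Lemma ec_isom_refl {F : fieldType} (E : ellCurve F) : ec_isom E E.
Proof. by exists 1, 0, 0, 0; split; [exact: oner_neq0|split; ring]. Qed.

(** * Halving in the adelic and standard groups *)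

Lemma adelic_halving {R : realType} {K : fieldType} {M : K} (E : ellCurve K)
    (P : adelic_points R E) :
  ec_model E = family_model M ->
  3 != 0 :> K -> 2 * M != 0 -> family_a M != 0 ->
  tg_add P P = (fun=> @ECPoint _ _ None isT) ->
  exists Q : adelic_points R E, tg_add Q Q = P.
Proof.
move=> EM three0 M0 a0 PP.
(* Each completion is an extension of K, so the family result applies there; the halves are chosen
   prime by prime, as E(A_K) is the full product. *)
have half p : exists Q, ec_add Q Q = P p.
  set f := to_completion (prime_av p).
  apply: (@family_halving _ (f M)).
  - by rewrite /= EM family_model_morph.
  - by rewrite -(rmorph_nat f) fmorph_eq0.
  - by rewrite -(rmorph_nat f) -rmorphM fmorph_eq0.
  - by rewrite -family_a_morph fmorph_eq0.
  - exact: (congr1 val (congr1 (fun z => z p) PP)).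
exists (fun p => sval (cid (half p))).
by apply: functional_extensionality_dep => p; exact: (svalP (cid (half p))).
Qed.

Lemma standard_group_not_halving {R : realType} (n : nat) :
  exists z s : standard_group R n,
    [/\ right_id z (@tg_add (standard_group R n)), tg_add s s = z
      & forall t, tg_add t t <> s].
Proof.
have zhat0 : (fun m => ord0 : 'I_m.+1) \in zhat.
  by apply/mem_set => d m _ /=; rewrite mod0n.
pose z12 : tg_pair (tg_power (tg_circle R) n) (tg_power tg_zhat n) :=
  (fun=> (0 : {ideal_quot (@integers R)}), fun=> SigSub zhat0).
pose z : standard_group R n := (z12, fun m => ord0 : 'I_m.+1).
(* Index 1 is the factor Z/2, since [tg_cyclic m] is Z/(m+1); [s] is its generator, and every double
   vanishes there. *)
pose s : standard_group R n := (z12, fun m => if m == 1%N then inord 1 else ord0 : 'I_m.+1).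
have z12r : right_id z12 (@tg_add _).
  case=> [x1 x2]; congr pair; apply/funext => i /=.
    exact: addr0.
  apply: val_inj; apply: functional_extensionality_dep => m /=; exact: addr0.
exists z, s; split.
- by case=> [x y]; congr pair; [exact: z12r|apply: functional_extensionality_dep => m; exact: addr0].
- congr pair; first exact: z12r.
  apply: functional_extensionality_dep => m /=; apply: val_inj => /=.
  have [->|_] := eqVneq m 1%N; last by rewrite mod0n.
  by rewrite inordK.
- case=> x y /(congr1 (fun w => val (w.2 1%N))) /=; rewrite inordK//.
  by case: (y 1%N) => [[|[|?]] ?].
Qed.

(** * The infinite set of curves over the number field *)

Theorem theorem1p2 (R : realType) (K : fieldExtType rat) (n : nat)
    (degK : \dim {:K}%VS = n)
    (Kbar : closedFieldType) (iota : {rmorphism K -> Kbar})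
    (Kbar_alg : forall z : Kbar, algebraicOver iota z) :
  exists S : set (ellCurve K),
    [/\ infinite_set S,
        forall E1 E2, S E1 -> S E2 -> E1 <> E2 ->
          ~ ec_isom (ec_map iota E1) (ec_map iota E2)
      & forall E, S E -> ~ tg_isom (adelic_points R E) (standard_group R n)].
Proof.
(* The shift by 6 meets the bound in [family_a_gt0] and [family_j_inj]. *)
pose M (k : nat) : rat := (k + 6)%:R.
pose h : {rmorphism rat -> K} := in_alg K.
have M6 k : 6 <= M k by rewrite ler_nat leq_addl.
have nz (L : fieldType) (f : {rmorphism rat -> L}) k :
    [/\ 3 != 0 :> L, 2 * f (M k) != 0 & family_a (f (M k)) != 0].
  split; [|rewrite -(rmorph_nat f) -rmorphM|rewrite -family_a_morph].
  - by rewrite -(rmorph_nat f) fmorph_eq0.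
  - by rewrite fmorph_eq0 mulf_neq0// gt_eqF// (lt_le_trans _ (M6 k)).
  - by rewrite fmorph_eq0 gt_eqF// family_a_gt0.
have disc k : wdisc (family_model (h (M k))) != 0.
  have [h3 hM ha] := nz K h k.
  have hn d : d.+1%:R != 0 :> K by rewrite -(rmorph_nat h) fmorph_eq0.
  rewrite family_disc// (mulf_neq0 _ (expf_neq0 _ ha))//.
  by rewrite (mulf_neq0 _ (expf_neq0 _ (hn 26)))// oppr_eq0 (hn 63).
pose E k := EllCurve (disc k).
have isomE i j : ec_isom (ec_map iota (E i)) (ec_map iota (E j)) -> i = j.
  (* As the parameters are rational, equality of j descends from [Kbar] to [rat], where the order
     separates the values. *)
  pose g : {rmorphism rat -> Kbar} := iota \o h.
  have [g3 gi gai] := nz _ g i; have [_ gj _] := nz _ g j.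
  move=> /(@family_isom _ (g (M i)) (g (M j)))/=.
  rewrite !family_model_morph => /(_ erefl erefl g3 gi gj gai).
  rewrite -!(family_j_morph _ _ g) => /(fmorph_inj g) jE.
  have /eqP := family_j_inj _ _ _ (M6 i) (M6 j) jE.
  by rewrite eqr_nat eqn_add2r => /eqP.
exists (range E); split.
- rewrite (eq_finite_set (inj_card_eq _)); first exact: infinite_nat.
  move=> i j _ _ Eij; apply: isomE; rewrite Eij.
  exact: ec_isom_refl.
- by move=> _ _ [i _ <-] [j _ <-] Eij /isomE ij; apply: Eij; rewrite ij.
- move=> _ [k _ <-] [f [g [fK gK _ _ fM]]].
  have [h3 hM ha] := nz K h k.
  (* [g] carries [s] to an adelic point of order dividing 2; [f] carries a half of that point to a
     half of [s], which is impossible. *)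
  have gM x y : g (tg_add x y) = tg_add (g x) (g y).
    by rewrite -[in LHS](gK x) -[in LHS](gK y) -fM fK.
  have [z [s [zr ss sN]]] := @standard_group_not_halving R n.
  pose e : adelic_points R (E k) := fun=> @ECPoint _ _ None isT.
  have e_id (x : adelic_points R (E k)) : tg_add e x = x.
    by apply: functional_extensionality_dep => p; apply: val_inj.
  (* With [e] a left and [z] a right identity, e + g z = g (f e + z) = g (f e) = e. *)
  have gz : g z = e.
    by rewrite -[LHS]e_id -[e in LHS]fK -gM zr fK.
  have [Q QQ] := @adelic_halving R K _ (E k) (g s) erefl h3 hM ha
    (etrans (esym (gM s s)) (etrans (congr1 g ss) gz)).
  by apply: (sN (f Q)); rewrite -fM QQ gK.
Qed.
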